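(* Consider the expected spectrum efficiency maximization problem (E-SEM) with soft contracts described in the context, and let $\lambda^*=(\lambda_1^*,\dots,\lambda_N^* )$ be the optimal shadow prices (optimal dual variables, as defined in the context) of the demand constraints $\mathbb{E}[d_n]\le D_n$. The following policy is optimal for E-SEM. For any idle spectrum with information realization $\theta$: (1) define the weight of each vertex of the conflict graph $G$ as follows: each spot market user $m$ has weight $v_m(\theta)$, and each contract user $n$ has weight $\tau_n\widehat P_n+(1-\tau_n)u_n(\theta)-\lambda_n^*$; (2) allocate the spectrum to a maximum weight independent set of $G$ with these weights.
   Context: **Model.** There are finitely many spot market users $\mathcal M=\{1,\dots,M\}$ and contract users $\mathcal N=\{1,\dots,N\}$, and a finite simple conflict graph $G$ on $\mathcal M\sqcup\mathcal N$ (adjacent users cannot use the same spectrum simultaneously). There are $S$ units of spectrum, each idle with probability $\rho$; only idle spectrum can be allocated. The valuations of all users for a unit of spectrum form a random vector $\Theta=(v_1,\dots,v_M;u_1,\dots,u_N)$ with joint density $f_\Theta$ ($\Theta$ also denotes its range; $v_m(\theta),u_n(\theta)$ denote the components of a realization $\theta$). Idleness and valuations are i.i.d. across spectrum units, and valuations are independent of idleness. Contract user $n$ has constants $B_n$ (payment/utility when the demand is met), $D_n$ (demand), $\widehat P_n$ (unit penalty, i.e. unit utility loss, for each undelivered spectrum: soft contract) and a weighting factor $\tau_n\in[0,1]$. **E-SEM.** Let $I_1,\dots,I_I$ be the independent sets of $G$. A strategy assigns to each $\theta$ probabilities $a^{IS}_i(\theta)\in[0,1]$ that an idle spectrum $\theta$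 is given simultaneously to all users of $I_i$, with $\sum_{i}a^{IS}_i(\theta)\le 1$. Put $a_j(\theta)=\sum_{i:\,j\in I_i}a^{IS}_i(\theta)$ for each user $j$, and $\mathbb{E}[w^s_m]=\rho S\int a_m(\theta)v_m(\theta)f_\Theta(\theta)d\theta$, $\mathbb{E}[d_n]=\rho S\int a_n(\theta)f_\Theta(\theta)d\theta$, $\mathbb{E}[w^c_n]=B_n-\widehat P_n\max\{0,D_n-\mathbb{E}[d_n]\}$, $\mathbb{E}[\widetilde w^c_n]=\rho S\int a_n(\theta)u_n(\theta)f_\Theta(\theta)d\theta$. E-SEM: maximize $\mathbb{E}[W]=\sum_m\mathbb{E}[w^s_m]+\sum_n\big(\tau_n\mathbb{E}[w^c_n]+(1-\tau_n)\mathbb{E}[\widetilde w^c_n]\big)$ over strategies with $\mathbb{E}[d_n]\le D_n$ for all $n$. **Reduced problem.** Let $I^c_0=\emptyset$ and let $I^c_1,\dots,I^c_{I_c}$ be the nonempty independent sets of the subgraph of $G$ induced on $\mathcal N$; $l_n^i=1$ if $n\in I^c_i$ and $0$ otherwise. The side market of $I_i^c$ is the subgraph of $G$ induced on the spot market users not adjacent to any user in $I_i^c$; $z_i(\theta)$ is the total weight of a maximum weight independent set of this side market, with vertex weights $v_m(\theta)$. The reduced problem is: over functions $a_1,\dots,a_{I_c}$ on $\Theta$, maximize $\rho S\sum_{i=1}^{I_c}\int H_i(\theta)a_i(\theta)f_\Theta(\theta)d\theta$ subject to (i) $a_i(\theta)\ge0$; (ii) $\sum_{i=1}^{I_c}a_i(\theta)\le1$;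 (iii) $\mathbb{E}[d_n]:=\sum_{i=1}^{I_c}l_n^i\rho S\int a_i(\theta)f_\Theta(\theta)d\theta\le D_n$, where $H_i(\theta)=-z_0(\theta)+z_i(\theta)+\sum_n l_n^i(\tau_n\widehat P_n+(1-\tau_n)u_n(\theta))$. **Optimal shadow prices.** $\lambda^*$ is the vector of optimal dual variables for the constraints (iii): there are $a_i^*,\mu_i^*,\eta^*$ on $\Theta$ such that for all $\theta$, all $i\in\{1,\dots,I_c\}$ and all $n$: $a^*$ satisfies (i)-(iii); $\mu_i^*(\theta)\ge0$ and $\mu_i^*(\theta)a_i^*(\theta)=0$; $\eta^*(\theta)\ge0$ and $\eta^*(\theta)(1-\sum_ia_i^*(\theta))=0$; $\lambda_n^*\ge0$ and $\lambda_n^*(D_n-\mathbb{E}[d_n])=0$ (with $\mathbb{E}[d_n]$ computed from $a^*$); and, with $\dot w_i(\theta)=\rho S H_i(\theta)+\mu_i^*(\theta)-\eta^*(\theta)-\rho S\sum_nl_n^i\lambda_n^*$, one has $a_i^*(\theta)=0$ if $\dot w_i(\theta)<0$ and $a_i^*(\theta)=1$ if $\dot w_i(\theta)>0$. A maximum weight independent set is an independent set of largest total weight.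
   Formalization: With ties, an arbitrary choice of maximum weight independent set may fail; proved: some (possibly random) tie-breaking is optimal, any one meeting the demand constraints and complementary slackness with λ* is optimal, and every choice is optimal if the set is a.s. unique. *)

(* Defs.v *)
From HB Require Import structures.
From mathcomp Require Import all_boot all_order all_algebra.
From mathcomp Require Import all_classical all_reals all_analysis.
Set Implicit Arguments.
Unset Strict Implicit.
Unset Printing Implicit Defensive.
Import Order.TTheory GRing.Theory Num.Theory.
Import numFieldNormedType.Exports.
Local Open Scope classical_set_scope.
Local Open Scope ring_scope.

Section TuplePower.
Context d (T : measurableType d) (R : realType).

Definition tcons n (p : T * n.-tuple T) : n.+1.-tuple T :=
  [tuple of p.1 :: p.2].
Definition tuncons n (t : n.+1.-tuple T) : T * n.-tuple T :=
  (thead t, [tuple of behead t]).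

Lemma tconsK n : cancel (@tcons n) (@tuncons n).
Proof.
by move=> [x t]; rewrite /tuncons /tcons /= theadE; congr pair; apply: val_inj.
Qed.

Lemma measurable_tcons n : measurable_fun [set: T * n.-tuple T] (@tcons n).
Proof. exact: measurable_cons. Qed.

Lemma measurable_tuncons n : measurable_fun [set: n.+1.-tuple T] (@tuncons n).
Proof.
apply/measurable_fun_pairP; split.
  exact: measurable_tnth.
exact: measurable_behead.
Qed.

Section tcons_measure.
Context (n : nat) (m1 : {sigma_finite_measure set T -> \bar R}).
Context (m2 : {sigma_finite_measure set (n.-tuple T) -> \bar R}).

Definition tcons_measure : set (n.+1.-tuple T) -> \bar R :=
  pushforward (m1 \x m2)%E (@tcons n).

Let tcons_measure0 : tcons_measure set0 = 0%E.
Proof. by rewrite /tcons_measure /pushforward preimage_set0 measure0. Qed.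

Let tcons_measure_ge0 A : (0 <= tcons_measure A)%E.
Proof. by rewrite /tcons_measure /pushforward; exact: measure_ge0. Qed.

Let tcons_measure_sigma_additive : semi_sigma_additive tcons_measure.
Proof.
have mc := @measurable_tcons n.
move=> F mF tF mUF; rewrite /tcons_measure /pushforward preimage_bigcup.
apply: measure_semi_sigma_additive.
- by move=> k; rewrite -[X in measurable X]setTI; exact: mc.
- apply/trivIsetP => /= i j _ _ ij; rewrite -preimage_setI.
  by move/trivIsetP : tF => /(_ _ _ _ _ ij) ->//; rewrite preimage_set0.
- by rewrite -preimage_bigcup -[X in measurable X]setTI; exact: mc.
Qed.

HB.instance Definition _ := isMeasure.Build _ _ _ tcons_measure
  tcons_measure0 tcons_measure_ge0 tcons_measure_sigma_additive.

Let tcons_measure_sigma_finite : sigma_finite setT tcons_measure.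
Proof.
have /sigma_finiteP[F [TF ndF Foo]] := sigma_finiteT m1.
have /sigma_finiteP[G [TG ndG Goo]] := sigma_finiteT m2.
exists (fun k => @tuncons n @^-1` (F k `*` G k)).
  rewrite -preimage_bigcup (_ : \bigcup_k _ = setT) ?preimage_setT//.
  rewrite -setXTT TF TG predeqE => -[x y]; split.
    by move=> [k _ []/= ? ?]; split; exists k.
  move=> [/= [k _ Fkx] [l _ Gly]]; exists (maxn k l) => //; split.
  - by move: x Fkx; exact/subsetPset/ndF/leq_maxl.
  - by move: y Gly; exact/subsetPset/ndG/leq_maxr.
move=> k; have [mF Fkoo] := Foo k; have [mG Gkoo] := Goo k.
have mFG : measurable (F k `*` G k) by exact: measurableX.
split; first by rewrite -[X in measurable X]setTI; exact: measurable_tuncons.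
rewrite /tcons_measure /pushforward -comp_preimage.
rewrite (_ : _ \o _ = id); last by apply/funext => p; exact: tconsK.
by rewrite preimage_id product_measure1E// lte_mul_pinfty// ge0_fin_numE.
Qed.

HB.instance Definition _ := Measure_isSigmaFinite.Build _ _ _ tcons_measure
  tcons_measure_sigma_finite.

End tcons_measure.

(* The n-fold product of mu with itself, on the n-tuples over T. *)
Fixpoint tuple_measure (mu : {sigma_finite_measure set T -> \bar R}) n :
    {sigma_finite_measure set (n.-tuple T) -> \bar R} :=
  match n with
  | 0 => \d_ [tuple]
  | n'.+1 => tcons_measure mu (tuple_measure mu n')
  end.

Lemma tuple_measure_box (mu : {sigma_finite_measure set T -> \bar R}) n
    (A : 'I_n -> set T) : (forall i, measurable (A i)) ->
  (tuple_measure mu n [set t | forall i, A i (tnth t i)]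
     = \prod_(i < n) mu (A i))%E.
Proof.
elim: n A => [|n IH] A mA.
  by rewrite big_ord0 /= diracE mem_set//= => i; case: i.
rewrite big_ord_recl -IH//= /tcons_measure /pushforward.
rewrite -product_measure1E//; last first.
  rewrite (_ : [set _ | _] = \bigcap_(i in [set` index_enum 'I_n])
      ((@tnth n T)^~ i @^-1` A (lift ord0 i))).
    rewrite bigcap_seq; apply: bigsetI_measurable => i _.
    by rewrite -[X in measurable X]setTI; exact: measurable_tnth.
  apply/seteqP; split => [t /= At i _|t /= At i]; first exact: At.
  by apply: At; rewrite /= mem_index_enum.
congr (_ _); apply/seteqP; split=> [[x t] /= At|[x t] /= [Ax At] i].
  split; first by have := At ord0; rewrite tnth0.
  by move=> i; have := At (lift ord0 i); rewrite tnthS.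
by case: (unliftP ord0 i) => [j ->|->]; rewrite ?tnthS ?tnth0.
Qed.

End TuplePower.

Definition lebesgue_tuple (R : realType) n :
    {sigma_finite_measure set (n.-tuple (measurableTypeR R)) -> \bar R} :=
  tuple_measure (@lebesgue_measure R) n.

Section Graph.
Context (V : finType) (R : realType).

Definition independent (e : rel V) (A : {set V}) : bool :=
  [forall x in A, forall y in A, ~~ e x y].

Definition weight (w : V -> R) (A : {set V}) : R := \sum_(x in A) w x.

(* The independent sets of the subgraph of e induced on U are the independent
   sets of e contained in U. *)
Definition max_weight_indep (e : rel V) (U : {set V}) (w : V -> R)
    (A : {set V}) : Prop :=
  [/\ A \subset U, independent e A &
      forall B : {set V}, B \subset U -> independent e B ->
        weight w B <= weight w A].

Definition max_indep_weight (e : rel V) (U : {set V}) (w : V -> R) : R :=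
  weight w
    [arg max_(A > finset.set0 | (A \subset U) && independent e A) weight w A]%O.

End Graph.

Definition user (M N : nat) : finType := ('I_M + 'I_N)%type.

(* Realizations theta = (v_1, .., v_M, u_1, .., u_N). *)
Definition realization (R : realType) (M N : nat) :=
  (M + N)%N.-tuple (measurableTypeR R).

Definition spot_value (R : realType) (M N : nat) (m : 'I_M)
  (t : realization R M N) : R := tnth t (lshift N m).

Definition contract_value (R : realType) (M N : nat) (n : 'I_N)
  (t : realization R M N) : R := tnth t (rshift M n).

(* The integrability field says that all valuations have a finite mean. *)
Record market (R : realType) (M N : nat) := Market {
  conflict : rel (user M N);
  conflict_sym : symmetric conflict;
  conflict_irr : irreflexive conflict;
  units : nat;
  rho : R;
  rho_bounds : 0 <= rho <= 1;
  Theta : set (realization R M N);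
  measurable_Theta : measurable Theta;
  density : realization R M N -> R;
  measurable_density : measurable_fun Theta density;
  density_ge0 : forall t, Theta t -> 0 <= density t;
  density_total :
    (\int[lebesgue_tuple R (M + N)%N]_(t in Theta) (density t)%:E = 1)%E;
  spot_integrable : forall m, (lebesgue_tuple R (M + N)%N).-integrable Theta
    (fun t => (spot_value m t * density t)%:E);
  contract_integrable : forall n, (lebesgue_tuple R (M + N)%N).-integrable Theta
    (fun t => (contract_value n t * density t)%:E);
  payment : 'I_N -> R;
  demand : 'I_N -> R;
  penalty : 'I_N -> R;
  tau : 'I_N -> R;
  tau_bounds : forall n, 0 <= tau n <= 1
}.

Section ESEM.
Context (R : realType) (M N : nat) (k : market R M N).

Local Notation e := (conflict k).
Local Notation T := (realization R M N).

Definition expected_total (g : T -> R) : R :=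
  rho k * (units k)%:R *
  Rintegral (lebesgue_tuple R (M + N)%N) (Theta k) (fun t => g t * density k t).

(* a I t is the probability that an idle unit with realization t is given to
   the independent set I; the values of a at sets I that are not independent
   are irrelevant. *)
Definition is_strategy (a : {set user M N} -> T -> R) : Prop :=
  [/\ forall I, independent e I -> measurable_fun (Theta k) (a I),
      forall I t, independent e I -> Theta k t -> 0 <= a I t <= 1 &
      forall t, Theta k t -> \sum_(I | independent e I) a I t <= 1].

Definition user_share (a : {set user M N} -> T -> R) (j : user M N) (t : T) : R :=
  \sum_(I | independent e I && (j \in I)) a I t.

Definition spot_welfare a (m : 'I_M) : R :=
  expected_total (fun t => user_share a (inl m) t * spot_value m t).

Definition delivery a (n : 'I_N) : R := expected_total (user_share a (inr n)).

Definition contract_welfare a (n : 'I_N) : R :=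
  payment k n - penalty k n * Num.max 0 (demand k n - delivery a n).

Definition contract_usage_welfare a (n : 'I_N) : R :=
  expected_total (fun t => user_share a (inr n) t * contract_value n t).

Definition total_welfare a : R :=
  \sum_m spot_welfare a m +
  \sum_n (tau k n * contract_welfare a n +
          (1 - tau k n) * contract_usage_welfare a n).

Definition feasible a : Prop :=
  is_strategy a /\ forall n, delivery a n <= demand k n.

Definition optimal a : Prop :=
  feasible a /\ forall b, feasible b -> total_welfare b <= total_welfare a.

Definition contract_conflict : rel 'I_N := [rel x y | e (inr x) (inr y)].
Definition spot_conflict : rel 'I_M := [rel x y | e (inl x) (inl y)].

Definition contract_class (C : {set 'I_N}) : bool :=
  (C != finset.set0) && independent contract_conflict C.

Definition side_market (C : {set 'I_N}) : {set 'I_M} :=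
  [set m | [forall n in C, ~~ e (inl m) (inr n)]]%SET.

Definition side_welfare (C : {set 'I_N}) (t : T) : R :=
  max_indep_weight spot_conflict (side_market C) (fun m => spot_value m t).

Definition contract_weight (n : 'I_N) (t : T) : R :=
  tau k n * penalty k n + (1 - tau k n) * contract_value n t.

Definition gain (C : {set 'I_N}) (t : T) : R :=
  - side_welfare finset.set0 t + side_welfare C t +
  \sum_(n in C) contract_weight n t.

Definition reduced_delivery (a : {set 'I_N} -> T -> R) (n : 'I_N) : R :=
  \sum_(C | contract_class C && (n \in C)) expected_total (a C).

(* lambda is the vector of optimal multipliers of the demand constraints of the
   reduced problem; a, mu, eta are the primal solution and the multipliers of
   the constraints 0 <= a and \sum a <= 1. *)
Definition optimal_shadow_prices (lambda : 'I_N -> R) : Prop :=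
  exists (a mu : {set 'I_N} -> T -> R) (eta : T -> R),
  let wdot C t :=
    rho k * (units k)%:R * gain C t + mu C t - eta t -
    rho k * (units k)%:R * \sum_(n in C) lambda n in
  [/\ forall C, contract_class C -> measurable_fun (Theta k) (a C),
      forall C t, contract_class C -> Theta k t ->
        [/\ 0 <= a C t, 0 <= mu C t, mu C t * a C t = 0,
            wdot C t < 0 -> a C t = 0 & 0 < wdot C t -> a C t = 1],
      forall t, Theta k t ->
        [/\ \sum_(C | contract_class C) a C t <= 1, 0 <= eta t &
            eta t * (1 - \sum_(C | contract_class C) a C t) = 0] &
      forall n, [/\ reduced_delivery a n <= demand k n, 0 <= lambda n &
                    lambda n * (demand k n - reduced_delivery a n) = 0]].

Definition policy_weight (lambda : 'I_N -> R) (t : T) (j : user M N) : R :=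
  match j with
  | inl m => spot_value m t
  | inr n => contract_weight n t - lambda n
  end.

Definition policy_set (lambda : 'I_N -> R) (t : T) (I : {set user M N}) : Prop :=
  max_weight_indep e [set: user M N]%SET (policy_weight lambda t) I.

(* For every realization the idle unit goes, with probability one, to maximum
   weight independent sets; ties may be broken in any way, also at random. *)
Definition follows_policy (lambda : 'I_N -> R) a : Prop :=
  [/\ is_strategy a,
      forall I t, independent e I -> Theta k t -> 0 < a I t ->
        policy_set lambda t I &
      forall t, Theta k t -> \sum_(I | independent e I) a I t = 1].

Definition ae_unique_policy_set (lambda : 'I_N -> R) : Prop :=
  {ae lebesgue_tuple R (M + N)%N, forall t, Theta k t -> 0 < density k t ->
    forall I J, policy_set lambda t I -> policy_set lambda t J -> I = J}.

End ESEM.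

(* Main.v *)
(* On feasible strategies every demand shortfall is nonnegative, so the welfare is
   affine in the strategy: a constant, plus the sum of lambda_n E[d_n], plus the
   mean weight of the served independent set for the policy weights.  A policy
   follower maximizes the last term pointwise, and complementary slackness
   makes it maximize the middle one (weak duality).  A policy follower with
   complementary slackness is obtained from the reduced solution: its optimality
   conditions say that it only uses contract classes whose best completion by
   spot users has maximum policy weight.  When the maximum weight set is a.e.
   unique, all policy followers have the deliveries of that one.  If rho S = 0
   the conditions on lambda carry no information, but all deliveries vanish. *)
Require Import Defs.
From mathcomp Require Import all_boot all_order all_algebra.
From mathcomp Require Import all_classical all_reals all_analysis.
From mathcomp Require Import measurable_realfun ring.
Set Implicit Arguments.
Unset Strict Implicit.
Unset Printing Implicit Defensive.
Import Order.TTheory GRing.Theory Num.Theory.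
Local Open Scope classical_set_scope.
Local Open Scope ring_scope.

(** * Measurable selection of maximizers, and the optimality conditions at one realization *)

Lemma measurable_argmax d (T : measurableType d) (R : realType) (F : finType)
    (P : pred F) (x0 : F) (w : F -> T -> R) :
  P x0 -> (forall x, measurable_fun setT (w x)) ->
  exists s : T -> F, (forall x, measurable_fun setT (fun t => s t == x)) /\
    forall t, P (s t) /\ forall y, P y -> w y t <= w (s t) t.
Proof.
move=> Px0 mw.
(* Induction on the candidates, with [x0] in front so that the list is never empty. The attained
   maximum is carried along as a measurable function, since the next candidate is compared with
   it. *)
suff [s [ms _ sP]] : exists s : T -> F,
    [/\ forall x, measurable_fun setT (fun t => s t == x),
        measurable_fun setT (fun t => w (s t) t) &
        forall t, s t \in x0 :: enum P /\
          forall y, y \in x0 :: enum P -> w y t <= w (s t) t].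
  exists s; split=> // t; have [st smax] := sP t; split.
    by move: st; rewrite inE mem_enum => /orP[/eqP ->|].
  by move=> y Py; apply: smax; rewrite inE mem_enum [y \in P]Py orbT.
elim: (enum P) => [|x l [s [ms mws sP]]].
  exists (fun=> x0); split=> // t; split; first exact: mem_head.
  by move=> y; rewrite inE => /eqP ->.
have mle : measurable_fun setT (fun t => w (s t) t <= w x t).
  exact: measurable_fun_ler.
exists (fun t => if w (s t) t <= w x t then x else s t); split.
- move=> y; rewrite (_ : (fun t => _) =
      (fun t => if w (s t) t <= w x t then x == y else s t == y)).
    exact: measurable_fun_ifT.
  by apply/funext => t; case: ifP.
- rewrite (_ : (fun t => _) =
      (fun t => if w (s t) t <= w x t then w x t else w (s t) t)).
    exact: measurable_fun_ifT.
  by apply/funext => t; case: ifP.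
- move=> t; have [st smax] := sP t; split.
    by case: ifP => _; move: st; rewrite !inE ?eqxx ?orbT// => /orP[->|->];
      rewrite ?orbT.
  have max_s y : y \in x0 :: l -> w y t <= w (s t) t by exact: smax.
  move=> y yl; have {yl} : (y == x) || (y \in x0 :: l).
    by move: yl; rewrite !inE orbCA.
  case: (leP (w (s t) t) (w x t)) => ws /orP[/eqP ->|/max_s]//.
    by move=> /le_trans; apply.
  exact: ltW.
Qed.

(** [eta] acts as a threshold: a class with positive probability has [h] at least [eta], one with
    probability below 1 has [h] at most [eta]. If [C] is used, every other class has probability
    below 1; if the total is below 1, slackness gives [eta = 0]. *)
Lemma kkt_support (R : realFieldType) (F : finType) (P : pred F)
    (x mu h : F -> R) (eta : R) :
  (forall C, P C -> [/\ 0 <= x C, 0 <= mu C, mu C * x C = 0,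
     h C + mu C - eta < 0 -> x C = 0 & 0 < h C + mu C - eta -> x C = 1]) ->
  \sum_(C | P C) x C <= 1 -> 0 <= eta ->
  eta * (1 - \sum_(C | P C) x C) = 0 ->
  [/\ forall C D, P C -> P D -> 0 < x C -> h D <= h C,
      forall C, P C -> 0 < x C -> 0 <= h C &
      forall C, P C -> \sum_(C | P C) x C < 1 -> h C <= 0].
Proof.
move=> xP x1 eta0 etax.
(* Positive [x C] forces [mu C = 0], and then [h C < eta] would force [x C = 0]. *)
have hge C : P C -> 0 < x C -> eta <= h C.
  move=> PC xC; have [_ _ /eqP + neg _] := xP C PC.
  rewrite mulf_eq0 (gt_eqF xC) orbF => /eqP muC; rewrite muC in neg.
  rewrite leNgt; apply/negP => hC; have := neg; rewrite (_ : _ < 0).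
    by move=> /(_ isT) xC0; rewrite xC0 ltxx in xC.
  by rewrite addr0 subr_lt0.
have hle D : P D -> x D < 1 -> h D <= eta.
  move=> PD xD; have [_ muD _ _ pos] := xP D PD.
  rewrite leNgt; apply/negP => hD; have := pos; rewrite (_ : 0 < _).
    by move=> /(_ isT) xD1; rewrite xD1 ltxx in xD.
  by rewrite subr_gt0 (lt_le_trans hD)// lerDl.
have xge0 C : P C -> 0 <= x C by move=> /xP[].
split=> [C D PC PD xC|C PC xC|C PC sx].
- have [->//|DC] := eqVneq D C.
  apply: (le_trans _ (hge C PC xC)); apply: hle => //.
  apply: lt_le_trans x1; rewrite (bigD1 D)//= (bigD1 C)/=; last first.
    by rewrite PC eq_sym.
  rewrite ltrDl ltr_wpDr// sumr_ge0// => E /andP[/andP[PE _] _].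
  exact: xge0.
- exact: le_trans (hge C PC xC).
- have eta_eq0 : eta = 0.
    by move/eqP: etax; rewrite mulf_eq0 subr_eq0 (gt_eqF sx) orbF => /eqP.
  rewrite -eta_eq0; apply: hle => //; apply: le_lt_trans sx.
  by rewrite (bigD1 C)//= lerDl sumr_ge0// => E /andP[PE _]; exact: xge0.
Qed.

(** * Integrability and linearity of expected totals *)

Section ExpectedTotal.
Context (R : realType) (M N : nat) (k : market R M N).
Local Notation T := (realization R M N).
Local Notation leb := (lebesgue_tuple R (M + N)%N).

Definition mean_integrable (g : T -> R) :=
  leb.-integrable (Theta k) (fun t => (g t * density k t)%:E).

Let mTheta : measurable (Theta k) := measurable_Theta k.

Lemma mean_integrable_eq (f g : T -> R) :
  (forall t, Theta k t -> f t = g t) -> mean_integrable f -> mean_integrable g.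
Proof.
by move=> fg; apply: eq_integrable => // t /set_mem /fg ->.
Qed.

Lemma mean_integrable_bounded (h g : T -> R) :
  measurable_fun (Theta k) h -> (forall t, Theta k t -> 0 <= h t <= 1) ->
  mean_integrable g -> mean_integrable (fun t => h t * g t).
Proof.
move=> mh h01 ig.
have := @integrableMr _ _ _ leb _ mTheta h _ mh _ ig.
rewrite /mean_integrable => H; apply: eq_integrable (H _) => //.
  by move=> t _ /=; rewrite -EFinM mulrA.
(* Boundedness is an eventual statement: every [B] above the witness 1 has to bound [h]. *)
exists 1; split=> // B B1 t /= /h01 /andP[h0 h1].
by rewrite ger0_norm// (le_trans h1)// ltW.
Qed.

Lemma mean_integrable1 : mean_integrable (fun=> 1).
Proof.
apply/integrableP; split.
  apply/measurable_EFinP; under eq_fun do rewrite mul1r.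
  exact: measurable_density.
rewrite (_ : \int[_]_(_ in _) _ = 1)%E ?ltry// -(density_total k).
apply: eq_integral => t /set_mem Tt.
by rewrite mul1r gee0_abs// lee_fin density_ge0.
Qed.

Lemma mean_integrableD (f g : T -> R) : mean_integrable f ->
  mean_integrable g -> mean_integrable (fun t => f t + g t).
Proof.
move=> fi gi; have := integrableD mTheta fi gi; apply: eq_integrable => // t _.
by rewrite /= -EFinD mulrDl.
Qed.

Lemma mean_integrableZ (r : R) (f : T -> R) :
  mean_integrable f -> mean_integrable (fun t => r * f t).
Proof.
move=> fi; have := integrableZl mTheta r fi; apply: eq_integrable => // t _.
by rewrite /= -EFinM mulrA.
Qed.

Lemma mean_integrable_sum (I : Type) (s : seq I) (P : pred I) (f : I -> T -> R) :
  (forall i, P i -> mean_integrable (f i)) ->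
  mean_integrable (fun t => \sum_(i <- s | P i) f i t).
Proof.
move=> fi; have := integrable_sum mTheta s fi; apply: eq_integrable => // t _.
by rewrite /= mulr_suml sumEFin.
Qed.

Lemma eq_expected_total (f g : T -> R) :
  (forall t, Theta k t -> f t = g t) -> expected_total k f = expected_total k g.
Proof.
move=> fg; congr (_ * _); apply: eq_Rintegral => t /set_mem Tt.
by rewrite fg.
Qed.

Lemma expected_totalD (f g : T -> R) : mean_integrable f ->
  mean_integrable g ->
  expected_total k (fun t => f t + g t) = expected_total k f + expected_total k g.
Proof.
move=> fi gi; rewrite /expected_total -mulrDr -RintegralD//; congr (_ * _).
by apply: eq_Rintegral => t _; rewrite mulrDl.
Qed.

Lemma expected_totalZ (r : R) (f : T -> R) : mean_integrable f ->
  expected_total k (fun t => r * f t) = r * expected_total k f.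
Proof.
move=> fi; rewrite /expected_total [RHS]mulrCA -(RintegralZl r)//; congr (_ * _).
by apply: eq_Rintegral => t _; rewrite mulrA.
Qed.

Lemma expected_total_sum (I : Type) (s : seq I) (P : pred I) (f : I -> T -> R) :
  (forall i, P i -> mean_integrable (f i)) ->
  expected_total k (fun t => \sum_(i <- s | P i) f i t) =
  \sum_(i <- s | P i) expected_total k (f i).
Proof.
move=> fi; elim: s => [|i s IH].
  rewrite big_nil (@eq_expected_total _ (fun t => 0 * 1)).
    by rewrite expected_totalZ ?mul0r//; exact: mean_integrable1.
  by move=> t _; rewrite big_nil mul0r.
rewrite big_cons; case: ifPn => Pi; rewrite -IH.
  rewrite -expected_totalD//; [|exact: fi|exact: mean_integrable_sum].
  by apply: eq_expected_total => t _; rewrite big_cons Pi.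
by apply: eq_expected_total => t _; rewrite big_cons (negbTE Pi).
Qed.

Lemma le_expected_total (f g : T -> R) : mean_integrable f ->
  mean_integrable g -> (forall t, Theta k t -> f t <= g t) ->
  expected_total k f <= expected_total k g.
Proof.
move=> fi gi fg; rewrite ler_wpM2l//.
  by rewrite mulr_ge0//; case/andP: (rho_bounds k).
apply: le_Rintegral => // t Tt; rewrite ler_wpM2r ?fg//.
exact: density_ge0.
Qed.

(** Where the density vanishes both integrands are 0, so agreement is required only where it is
    positive. *)
Lemma ae_eq_expected_total (f g : T -> R) : mean_integrable f ->
  mean_integrable g ->
  {ae leb, forall t, Theta k t -> 0 < density k t -> f t = g t} ->
  expected_total k f = expected_total k g.
Proof.
move=> fi gi fg; rewrite /expected_total /Rintegral; congr (_ * fine _).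
apply: ae_eq_integral => //; [exact: measurable_int fi|exact: measurable_int gi|].
apply: filterS fg => t fg Tt; congr (_%:E).
have := density_ge0 Tt; rewrite le_eqVlt => /predU1P[<-|d0]; first by rewrite !mulr0.
by rewrite fg.
Qed.

End ExpectedTotal.

(** * Weak duality for the demand constraints *)

Section Duality.
Context (R : realType) (M N : nat) (k : market R M N).
Local Notation T := (realization R M N).
Local Notation e := (conflict k).

Lemma measurable_spot_value m : measurable_fun setT (@spot_value R M N m).
Proof. exact: measurable_tnth. Qed.

Lemma measurable_contract_value n :
  measurable_fun setT (@contract_value R M N n).
Proof. exact: measurable_tnth. Qed.

Lemma measurable_policy_weight (lambda : 'I_N -> R) j :
  measurable_fun setT (fun t : T => policy_weight k lambda t j).
Proof.
case: j => [m|n] /=; first exact: measurable_spot_value.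
apply: measurable_funB => //; apply: measurable_funD => //.
by apply: measurable_funM => //; exact: measurable_contract_value.
Qed.

Lemma measurable_policy_total (lambda : 'I_N -> R) I :
  measurable_fun setT (fun t : T => weight (policy_weight k lambda t) I).
Proof.
rewrite /weight (_ : (fun t => _) = (fun t : T =>
  \sum_j if j \in I then policy_weight k lambda t j else 0)).
  apply: measurable_sum => j; case: (j \in I) => //.
  exact: measurable_policy_weight.
by apply/funext => t; rewrite big_mkcond.
Qed.

Lemma mean_integrable_policy_weight (lambda : 'I_N -> R) j :
  mean_integrable k (fun t : T => policy_weight k lambda t j).
Proof.
case: j => [m|n] /=; first exact: spot_integrable.
(* A contract user's weight is affine in the valuation; its constant part is integrable because the
   density has total mass 1. *)
have := mean_integrableD (mean_integrableZ (1 - tau k n) (contract_integrable k n))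
  (mean_integrableZ (tau k n * penalty k n - lambda n) (mean_integrable1 k)).
by apply: mean_integrable_eq => t _; rewrite /contract_weight; ring.
Qed.

Section Strategy.
Context (a : {set user M N} -> T -> R) (sa : is_strategy k a).

Lemma measurable_user_share j : measurable_fun (Theta k) (user_share k a j).
Proof.
have [ma _ _] := sa.
rewrite (_ : user_share k a j = fun t => \sum_I
    if independent e I && (j \in I) then a I t else 0).
  apply: measurable_sum => I; case iI: (_ && _) => //.
  by case/andP: iI => iI _; exact: ma.
by apply/funext => t; rewrite /user_share big_mkcond.
Qed.

Lemma user_share_bounds j t : Theta k t -> 0 <= user_share k a j t <= 1.
Proof.
have [_ a01 a1] := sa; move=> Tt.
have a0 I : independent e I -> 0 <= a I t by move=> iI; case/andP: (a01 I t iI Tt).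
rewrite /user_share sumr_ge0//=; last by move=> I /andP[iI _]; exact: a0.
apply: le_trans (a1 t Tt).
rewrite big_mkcondr; apply: ler_sum => I iI; case: ifP => // _; exact: a0.
Qed.

Lemma mean_integrable_share j g : mean_integrable k g ->
  mean_integrable k (fun t => user_share k a j t * g t).
Proof.
apply: mean_integrable_bounded; first exact: measurable_user_share.
exact: user_share_bounds.
Qed.

Lemma mean_integrable_user_share j : mean_integrable k (user_share k a j).
Proof.
have := mean_integrable_share j (mean_integrable1 k).
by apply: mean_integrable_eq => t _; rewrite mulr1.
Qed.

(** The integrand of the Lagrangian with multipliers [lambda], up to constants. *)
Definition policy_value (lambda : 'I_N -> R) (t : T) : R :=
  \sum_(I | independent e I) a I t * weight (policy_weight k lambda t) I.

Lemma policy_value_share lambda t : policy_value lambda t =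
  \sum_j user_share k a j t * policy_weight k lambda t j.
Proof.
rewrite /policy_value /weight.
under eq_bigr do rewrite mulr_sumr.
under [RHS]eq_bigr do rewrite mulr_suml.
by rewrite (exchange_big_dep xpredT).
Qed.

Lemma mean_integrable_policy_value lambda :
  mean_integrable k (policy_value lambda).
Proof.
apply: (@mean_integrable_eq _ _ _ k (fun t =>
    \sum_j user_share k a j t * policy_weight k lambda t j)).
  by move=> t _; rewrite policy_value_share.
apply: mean_integrable_sum => j _.
exact: mean_integrable_share (mean_integrable_policy_weight lambda j).
Qed.

(** Met demand bounds select the linear branch of each [max]. The price term is then added and
    subtracted, so the identity holds for every [lambda]. *)
Lemma total_welfareE lambda : (forall n, delivery k a n <= demand k n) ->
  total_welfare k a =
  \sum_n tau k n * (payment k n - penalty k n * demand k n) +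
  \sum_n lambda n * delivery k a n + expected_total k (policy_value lambda).
Proof.
move=> dle.
have pv n : expected_total k (fun t => user_share k a (inr n) t *
      policy_weight k lambda t (inr n)) =
    (tau k n * penalty k n - lambda n) * delivery k a n +
    (1 - tau k n) * contract_usage_welfare k a n.
  have i1 := mean_integrable_user_share (inr n).
  have i2 := mean_integrable_share (inr n) (contract_integrable k n).
  rewrite /delivery /contract_usage_welfare -!expected_totalZ// -expected_totalD;
    try exact: mean_integrableZ.
  by apply: eq_expected_total => t _ /=; rewrite /contract_weight; ring.
rewrite (eq_expected_total (fun t _ => policy_value_share lambda t)).
rewrite expected_total_sum; last first.
  by move=> j _; apply: mean_integrable_share (mean_integrable_policy_weight lambda j).
rewrite big_sumType /= addrCA -big_split/=; congr (_ + _).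
rewrite -big_split/=; apply: eq_bigr => n _.
rewrite pv /contract_welfare max_r ?subr_ge0//; ring.
Qed.

End Strategy.

(** All sets served by [a] have the same maximal weight and total probability 1, so its value is the
    weight of any one of them, [I0]. The rival averages weights that are at most this one. *)
Lemma policy_value_le lambda a b t : Theta k t ->
  is_strategy k b -> follows_policy k lambda a ->
  policy_value b lambda t <= policy_value a lambda t.
Proof.
move=> Tt [_ b01 b1] [[_ a01 _] amax a1].
set w := weight (policy_weight k lambda t).
have [I0 iI0 aI0] : exists2 I, independent e I & 0 < a I t.
  apply/not_exists2P => aN; have := a1 t Tt; rewrite big1 => [/eqP|I iI].
    by rewrite eq_sym oner_eq0.
  have [//|] := aN I; have /andP[] := a01 I t iI Tt.
  by rewrite le_eqVlt => /predU1P[|->].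
have [_ _ I0max] := amax I0 t iI0 Tt aI0.
(* The rival may leave probability unallocated; comparing [I0] with the empty set shows that this
   gains nothing. *)
have w0 : 0 <= w I0.
  have -> : 0 = w finset.set0 by rewrite /w /weight big_set0.
  apply: I0max; rewrite ?finset.subsetT//.
  by apply/forall_inP => x; rewrite inE.
rewrite [leRHS](_ : _ = w I0).
  apply: (@le_trans _ _ (\sum_(I | independent e I) b I t * w I0)).
    apply: ler_sum => I iI; rewrite ler_wpM2l//.
      by case/andP: (b01 I t iI Tt).
    by apply: I0max; rewrite ?finset.subsetT.
  by rewrite -mulr_suml ler_piMl// b1.
transitivity (\sum_(I | independent e I) a I t * w I0).
  apply: eq_bigr => I iI; have /andP[] := a01 I t iI Tt.
  rewrite le_eqVlt => /predU1P[<-|aI] _; first by rewrite !mul0r.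
  have [_ _ Imax] := amax I t iI Tt aI.
  congr (_ * _); apply/eqP; rewrite eq_le I0max ?finset.subsetT//=.
  by rewrite Imax ?finset.subsetT.
by rewrite -mulr_suml a1// mul1r.
Qed.

Lemma optimal_of_complementary lambda a : (forall n, 0 <= lambda n) ->
  follows_policy k lambda a -> (forall n, delivery k a n <= demand k n) ->
  (forall n, lambda n * (demand k n - delivery k a n) = 0) -> optimal k a.
Proof.
move=> l0 fa da cs; have [sa _ _] := fa; split=> // b [sb db].
rewrite (total_welfareE sb lambda db) (total_welfareE sa lambda da).
rewrite -!addrA lerD2l lerD//.
  (* Slackness replaces the delivery of [a] by the demand, which bounds the rival's delivery. *)
  apply: ler_sum => n _; have := cs n.
  rewrite mulrBr => /eqP; rewrite subr_eq0 => /eqP <-.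
  exact: ler_wpM2l.
apply: le_expected_total; try exact: mean_integrable_policy_value.
by move=> t Tt; exact: policy_value_le.
Qed.

(** Sets outside the policy have probability 0, so the whole mass falls on the single maximizer. *)
Lemma policy_unique_share lambda a t : follows_policy k lambda a -> Theta k t ->
  (forall I J, policy_set k lambda t I -> policy_set k lambda t J -> I = J) ->
  forall I, independent e I -> a I t = `[< policy_set k lambda t I >]%:R.
Proof.
move=> [[_ a01 _] amax a1] Tt uniq I iI.
have a0 J : independent e J -> ~ policy_set k lambda t J -> a J t = 0.
  move=> iJ nJ; have /andP[] := a01 J t iJ Tt.
  by rewrite le_eqVlt => /predU1P[//|/(amax J t iJ Tt)].
case: asboolP => [pI|/a0->//].
rewrite -(a1 t Tt) (bigD1 I)//= big1 ?addr0// => J /andP[iJ JI].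
by apply: a0 => // pJ; rewrite (uniq _ _ pI pJ) eqxx in JI.
Qed.

(** Transfers the demand bounds and complementary slackness from one policy follower to all
    others. *)
Lemma eq_delivery lambda a b : ae_unique_policy_set k lambda ->
  follows_policy k lambda a -> follows_policy k lambda b ->
  forall n, delivery k a n = delivery k b n.
Proof.
move=> uniq fa fb n; have [sa _ _] := fa; have [sb _ _] := fb.
apply: ae_eq_expected_total; try exact: mean_integrable_user_share.
apply: filterS uniq => t uniq Tt dt; apply: eq_bigr => I /andP[iI _].
by rewrite !(@policy_unique_share lambda _ t)//; exact: uniq.
Qed.

End Duality.

(** * Contract classes, and a policy follower built from the reduced solution *)

Section Construction.
Context (R : realType) (M N : nat) (k : market R M N).
Local Notation T := (realization R M N).
Local Notation e := (conflict k).

Definition spot_part (I : {set user M N}) : {set 'I_M} :=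
  [set m | inl m \in I]%SET.
Definition contract_part (I : {set user M N}) : {set 'I_N} :=
  [set n | inr n \in I]%SET.
Definition join_parts (J : {set 'I_M}) (C : {set 'I_N}) : {set user M N} :=
  [set j | match j with inl m => m \in J | inr n => n \in C end]%SET.

Lemma spot_part_join J C : spot_part (join_parts J C) = J.
Proof. by apply/setP => m; rewrite !inE. Qed.

Lemma contract_part_join J C : contract_part (join_parts J C) = C.
Proof. by apply/setP => m; rewrite !inE. Qed.

Lemma weight_parts (w : user M N -> R) I :
  weight w I = weight (w \o inl) (spot_part I) + weight (w \o inr) (contract_part I).
Proof.
rewrite /weight big_sumType/=; congr (_ + _); apply: eq_bigl => x; by rewrite inE.
Qed.

(** Conflicts are between two spot users, between two contract users, or mixed; lying in the side
    market excludes the mixed ones. *)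
Lemma independent_parts I : independent e I =
  [&& independent (spot_conflict k) (spot_part I),
      independent (contract_conflict k) (contract_part I) &
      spot_part I \subset side_market k (contract_part I)].
Proof.
apply/forall_inP/and3P => [eI|[/forall_inP iJ /forall_inP iC /fintype.subsetP JC]].
  have {}eI x y : x \in I -> y \in I -> ~~ e x y.
    by move=> xI yI; move/forall_inP: (eI x xI); apply.
  split.
  - by apply/forall_inP => m; rewrite inE => mI; apply/forall_inP => m';
      rewrite inE => mI'; exact: eI.
  - by apply/forall_inP => m; rewrite inE => mI; apply/forall_inP => m';
      rewrite inE => mI'; exact: eI.
  - apply/fintype.subsetP => m; rewrite !inE => mI; apply/forall_inP => n.
    by rewrite inE; exact: eI.
have cross m n : inl m \in I -> inr n \in I -> ~~ e (inl m) (inr n).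
  move=> mI nI; have := JC m; rewrite !inE => /(_ mI)/forall_inP/(_ n).
  by rewrite inE; apply.
move=> [m|n] xI; apply/forall_inP => -[m'|n'] yI.
- by have := iJ m; rewrite !inE => /(_ xI)/forall_inP/(_ m'); rewrite inE; apply.
- exact: cross.
(* The side market records mixed conflicts from the spot side only; symmetry gives the other
   orientation. *)
- by rewrite conflict_sym cross.
- by have := iC n; rewrite !inE => /(_ xI)/forall_inP/(_ n'); rewrite inE; apply.
Qed.

Lemma independent0 (V : finType) (r : rel V) : independent r finset.set0.
Proof. by apply/forall_inP => x; rewrite inE. Qed.

Lemma max_indep_weightP (V : finType) (r : rel V) (U : {set V}) (w : V -> R) :
  exists2 A, max_weight_indep r U w A & max_indep_weight r U w = weight w A.
Proof.
rewrite /max_indep_weight; case: arg_maxP => [|A /andP[AU rA] Amax].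
  by rewrite finset.sub0set independent0.
by exists A => //; split=> // B BU rB; apply: Amax; rewrite BU.
Qed.

(* The weight of the best independent set whose contract users are exactly [C]. *)
Definition class_value (lambda : 'I_N -> R) (t : T) (C : {set 'I_N}) : R :=
  side_welfare k C t + \sum_(n in C) (contract_weight k n t - lambda n).

(** The link to the reduced problem: classes are ranked by their gain minus prices, since the
    remaining term does not depend on [C]. *)
Lemma class_value_gain lambda t C : class_value lambda t C =
  side_welfare k finset.set0 t + (gain k C t - \sum_(n in C) lambda n).
Proof. by rewrite /class_value /gain sumrB; ring. Qed.

Lemma class_value0 lambda t :
  class_value lambda t finset.set0 = side_welfare k finset.set0 t.
Proof. by rewrite /class_value big_set0 addr0. Qed.

Lemma weight_le_class_value lambda t I : independent e I ->
  weight (policy_weight k lambda t) I <= class_value lambda t (contract_part I).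
Proof.
rewrite independent_parts => /and3P[iJ _ JC].
rewrite weight_parts /class_value /side_welfare lerD2r.
have [A [_ _ Amax] ->] := max_indep_weightP (spot_conflict k)
  (side_market k (contract_part I)) (fun m => spot_value m t).
exact: Amax.
Qed.

Lemma class_value_attained lambda t C : independent (contract_conflict k) C ->
  exists2 I, independent e I && (contract_part I == C) &
    weight (policy_weight k lambda t) I = class_value lambda t C.
Proof.
move=> iC; rewrite /class_value /side_welfare.
have [A [AC iA _] ->] := max_indep_weightP (spot_conflict k)
  (side_market k C) (fun m => spot_value m t).
exists (join_parts A C).
  by rewrite independent_parts spot_part_join contract_part_join iA iC AC eqxx.
by rewrite weight_parts spot_part_join contract_part_join.
Qed.

(** The best completion of each class is chosen measurably in the realization, so that the strategy
    built from it is measurable. *)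
Lemma class_selection lambda : exists s : {set 'I_N} -> T -> {set user M N},
  (forall C I, measurable_fun setT (fun t => s C t == I)) /\
  forall C t, independent (contract_conflict k) C ->
    [/\ independent e (s C t), contract_part (s C t) = C &
        weight (policy_weight k lambda t) (s C t) = class_value lambda t C].
Proof.
have /boolp.choice[s sP] C : exists s : T -> {set user M N},
    (forall I, measurable_fun setT (fun t => s t == I)) /\
    forall t, independent (contract_conflict k) C ->
    [/\ independent e (s t), contract_part (s t) = C &
        weight (policy_weight k lambda t) (s t) = class_value lambda t C].
  (* The implication keeps the candidates nonempty even when [C] is not independent. *)
  pose P I := independent (contract_conflict k) C ==>
    (independent e I && (contract_part I == C)).
  have P0 : P (join_parts finset.set0 C).
    apply/implyP => iC; rewrite independent_parts spot_part_join.
    by rewrite contract_part_join independent0 iC finset.sub0set eqxx.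
  have [s [ms sP]] := measurable_argmax P0 (measurable_policy_total k lambda).
  exists s; split=> // t iC; have [/implyP/(_ iC)/andP[ist /eqP sC] smax] := sP t.
  split=> //; apply/eqP; rewrite eq_le -{1}sC weight_le_class_value//=.
  have [I /andP[iI CI] <-] := class_value_attained lambda t iC.
  by apply: smax; rewrite /P iI CI implybT.
by exists s; split=> [C|C t]; [have [] := sP C | have [_] := sP C; apply].
Qed.

(* A unit is first assigned to a contract class according to the reduced
   solution, the empty class receiving the remaining probability, and then to a
   best independent set with these contract users. *)
Lemma shadow_price_policy_pos lambda :
  0 < rho k * (units k)%:R -> optimal_shadow_prices k lambda ->
  exists a, [/\ follows_policy k lambda a,
    forall n, delivery k a n <= demand k n &
    forall n, lambda n * (demand k n - delivery k a n) = 0].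
Proof.
move=> c0 [x [mu [eta [mx xP etaP dP]]]].
have [s [ms sP]] := class_selection lambda.
pose class C := independent (contract_conflict k) C.
pose p C t := if C == finset.set0
  then 1 - \sum_(C | contract_class k C) x C t else x C t.
pose a I t := p (contract_part I) t * (s (contract_part I) t == I)%:R.
have indep_class I : independent e I -> class (contract_part I).
  by rewrite independent_parts => /and3P[].
(* In each class only the selected set carries mass, so sums over independent sets collapse to sums
   over classes. [Q] is used for the total mass and for membership of a contract user. *)
have class_sum t (Q : pred {set 'I_N}) :
    \sum_(I | independent e I && Q (contract_part I)) a I t =
    \sum_(C | class C && Q C) p C t.
  rewrite (partition_big contract_part (fun C => class C && Q C))/=; last first.
    by move=> I /andP[/indep_class -> ->].
  apply: eq_bigr => C /andP[cC QC]; have [is_s Cs _] := sP C t cC.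
  rewrite (bigD1 (s C t)) /=; last by rewrite is_s Cs QC eqxx.
  rewrite big1 ?addr0; first by rewrite /a Cs eqxx mulr1.
  move=> I /andP[/andP[_ /eqP CI] sI].
  by rewrite /a CI eq_sym (negbTE sI) mulr0.
have p0 C t : Theta k t -> class C -> 0 <= p C t.
  move=> Tt cC; rewrite /p; case: eqVneq => [_|C0].
    by have [+ _ _] := etaP t Tt; rewrite subr_ge0.
  by have [] := xP C t _ Tt; rewrite /contract_class ?C0.
have p1 t : \sum_(C | class C) p C t = 1.
  rewrite (bigD1 finset.set0) /=; last exact: independent0.
  rewrite /p eqxx addrC; apply/eqP; rewrite addrA subr_eq addrC; apply/eqP.
  congr (_ + _); apply: eq_big => [C|C /andP[_ /negbTE ->]//].
  by rewrite andbC.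
have a_sum t : \sum_(I | independent e I) a I t = 1.
  rewrite -(p1 t); have := class_sum t xpredT => /=.
  by under eq_bigl do rewrite andbT; under [RHS]eq_bigl do rewrite andbT.
have a0 I t : independent e I -> Theta k t -> 0 <= a I t.
  by move=> /indep_class cI Tt; rewrite mulr_ge0 ?ler0n ?p0.
have mp C : class C -> measurable_fun (Theta k) (p C).
  have -> : p C = if C == finset.set0
      then fun t => 1 - \sum_(C | contract_class k C) x C t else x C.
    by apply/funext => t; rewrite /p; case: ifP.
  case: eqVneq => [_ _|C0 cC]; last by apply: mx; rewrite /contract_class C0.
  apply: measurable_funB => //.
  rewrite (_ : (fun t => _) = (fun t =>
    \sum_C if contract_class k C then x C t else 0)).
    by apply: measurable_sum => D; case D0: (contract_class k D) => //; exact: mx.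
  by apply/funext => t; rewrite big_mkcond.
have sa : is_strategy k a.
  split=> [I iI|I t iI Tt|t Tt]; last by rewrite a_sum.
    apply: measurable_funM; first by apply: mp; exact: indep_class.
    rewrite (_ : (fun t => _) =
      (fun t => if s (contract_part I) t == I then 1 else 0)).
      by apply: measurable_funTS; exact: measurable_fun_ifT.
    by apply/funext => t; case: (s _ t == I).
  rewrite a0//= -(a_sum t) (bigD1 I)//= lerDl sumr_ge0// => J /andP[iJ _].
  exact: a0.
(* The empty class serves no contract user, so the leftover mass does not affect deliveries. *)
have da n : delivery k a n = reduced_delivery k x n.
  rewrite /delivery /reduced_delivery -expected_total_sum; last first.
    move=> C /andP[cC nC]; apply: (@mean_integrable_eq _ _ _ k (fun t => x C t * 1)).
      by move=> t _; rewrite mulr1.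
    apply: mean_integrable_bounded (mean_integrable1 k); first exact: mx.
    move=> t Tt; have [x0 _ _ _ _] := xP C t cC Tt; rewrite x0/=.
    have [+ _ _] := etaP t Tt; apply: le_trans.
    rewrite (bigD1 C)//= lerDl sumr_ge0// => D /andP[cD _].
    by have [] := xP D t cD Tt.
  apply: eq_expected_total => t _.
  rewrite /user_share (eq_bigl (fun I => independent e I &&
    (n \in contract_part I))); last by move=> I; rewrite inE.
  rewrite (class_sum t (fun C => n \in C)); apply: eq_big => [C|C /andP[_ nC]].
    rewrite /contract_class; case: eqVneq => //= ->.
    by rewrite inE andbF.
  by rewrite /p; case: eqVneq => // C0; rewrite C0 inE in nC.
exists a; split; last 2 first.
- by move=> n; rewrite da; have [] := dP n.
- by move=> n; rewrite da; have [] := dP n.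
split=> // I t iI Tt aI.
have cI := indep_class I iI; have [_ Cs ws] := sP _ t cI.
have sI : s (contract_part I) t = I.
  apply/eqP; apply: contraTT aI => /negbTE sI.
  by rewrite /a sI mulr0 ltxx.
have pI : 0 < p (contract_part I) t by move: aI; rewrite /a sI eqxx mulr1.
(* Any independent set weighs at most the value of its class, so comparing classes suffices. *)
suff Vmax D : class D ->
    class_value lambda t D <= class_value lambda t (contract_part I).
  split=> [||B _ iB]; rewrite ?finset.subsetT//.
  rewrite -[in leRHS]sI ws; apply: le_trans (Vmax _ (indep_class B iB)).
  exact: weight_le_class_value.
have [x1 eta0 etax] := etaP t Tt.
pose h C := rho k * (units k)%:R * (gain k C t - \sum_(n in C) lambda n).
have [|h_le h_ge0 h_le0] :=
    @kkt_support _ _ (contract_class k) (x^~ t) (mu^~ t) h _ _ x1 eta0 etax.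
  move=> C cC; have [x0 mu0 mux neg pos] := xP C t cC Tt.
  have E : h C + mu C t - eta t = rho k * (units k)%:R * gain k C t + mu C t -
      eta t - rho k * (units k)%:R * \sum_(n in C) lambda n by rewrite /h; ring.
  by rewrite E.
have cls C : class C -> C != finset.set0 -> contract_class k C.
  by move=> cC C0; rewrite /contract_class C0.
rewrite -(ler_pM2l c0) => {}cD.
(* The empty class is the baseline, with [h] equal to 0. If it has mass, the other classes sum to
   less than 1 and none has positive [h]; if a nonempty class has mass, its [h] is nonnegative and
   largest. *)
move: pI; rewrite /p; case: (eqVneq (contract_part I)) => [->|I0] pI.
  rewrite class_value0; have [->|D0] := eqVneq D finset.set0.
    by rewrite class_value0.
  rewrite class_value_gain mulrDr gerDl; apply: h_le0; first exact: cls.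
  by rewrite -subr_gt0.
have [->|D0] := eqVneq D finset.set0.
  rewrite class_value0 class_value_gain mulrDr lerDl.
  by apply: h_ge0 => //; exact: cls.
rewrite !class_value_gain ler_pM2l// lerD2l -(ler_pM2l c0).
by apply: h_le => //; exact: cls.
Qed.

(** Actual and reduced deliveries are all 0, so the demand conditions on [lambda] carry over to any
    strategy; a measurable deterministic maximizer serves as the follower. *)
Lemma shadow_price_policy0 lambda :
  rho k * (units k)%:R = 0 -> optimal_shadow_prices k lambda ->
  exists a, [/\ follows_policy k lambda a,
    forall n, delivery k a n <= demand k n &
    forall n, lambda n * (demand k n - delivery k a n) = 0].
Proof.
move=> c0 [x [mu [eta [_ _ _ dP]]]].
have et0 g : expected_total k g = 0 by rewrite /expected_total c0 mul0r.
have [s [ms sP]] :=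
  measurable_argmax (independent0 e) (measurable_policy_total k lambda).
have rd n : reduced_delivery k x n = 0 by rewrite /reduced_delivery big1.
exists (fun I t => (s t == I)%:R); split.
- have s1 t : \sum_(I | independent e I) (s t == I)%:R = 1 :> R.
    have [is_s _] := sP t; rewrite (bigD1 (s t))//= eqxx big1 ?addr0// => I.
    by move=> /andP[_]; rewrite eq_sym => /negbTE ->.
  split=> [|I t iI Tt|//].
    split=> [I iI|I t iI Tt|t Tt]; last by rewrite s1.
      rewrite (_ : (fun t => _) = (fun t => if s t == I then 1 else 0)).
        by apply: measurable_funTS; exact: measurable_fun_ifT.
      by apply/funext => t; case: (s t == I).
    by rewrite ler0n lern1 leq_b1.
  case: eqP => [<- _|_]; last by rewrite ltxx.
  have [is_s smax] := sP t.
  by split; rewrite ?finset.subsetT// => B _; exact: smax.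
- by move=> n; have [+ _ _] := dP n; rewrite /delivery et0 rd.
- by move=> n; have [_ _] := dP n; rewrite /delivery et0 rd.
Qed.

End Construction.

Theorem theorem1 (R : realType) (M N : nat) (k : market R M N)
    (lambda : 'I_N -> R) (hlambda : optimal_shadow_prices k lambda) :
  (exists a, follows_policy k lambda a /\ optimal k a) /\
  (forall a, follows_policy k lambda a ->
     (forall n, delivery k a n <= demand k n) ->
     (forall n, lambda n * (demand k n - delivery k a n) = 0) ->
     optimal k a) /\
  (ae_unique_policy_set k lambda ->
     forall a, follows_policy k lambda a -> optimal k a).
Proof.
have l0 n : 0 <= lambda n.
  by case: hlambda => x [mu [eta [_ _ _ /(_ n)[]]]].
have [a [fa da ca]] : exists a, [/\ follows_policy k lambda a,
    forall n, delivery k a n <= demand k n &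
    forall n, lambda n * (demand k n - delivery k a n) = 0].
  (* The optimality conditions are scaled by [rho S] and rank the classes only when it is
     positive. *)
  have : 0 <= rho k * (units k)%:R.
    by rewrite mulr_ge0//; case/andP: (rho_bounds k).
  rewrite le_eqVlt => /predU1P[/esym c0|c0].
    exact: shadow_price_policy0.
  exact: shadow_price_policy_pos.
have opt b := @optimal_of_complementary _ _ _ k lambda b l0.
split; [|split].
- by exists a; split=> //; exact: opt.
- exact: opt.
- move=> uniq b fb; have ba := eq_delivery uniq fb fa.
  by apply: opt => // n; rewrite ba.
Qed.
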